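(* For every positive integer $r$ there exists a constant $C=C(r)$ such that for all positive integers $n,k$ with $n>Ck$, every regular intersecting family $\mathcal{F}\subset\binom{[n]}{k}$ satisfies $$|\mathcal{F}|\le C\binom{n-r}{k-r}.$$
   Context: $[n]=\{1,\dots,n\}$ and $\binom{[n]}{k}$ is the set of $k$-element subsets of $[n]$. A family is intersecting if any two of its members intersect. The degree of $x\in[n]$ is the number of members of $\mathcal{F}$ containing $x$; $\mathcal{F}$ is regular if all elements of $[n]$ have the same degree. *)

(* Defs.v *)
From HB Require Import structures.
From mathcomp Require Import all_boot all_order all_algebra.
From mathcomp Require Import reals.

Set Implicit Arguments.
Unset Strict Implicit.
Unset Printing Implicit Defensive.

(* The ground set [n] = {1, ..., n} is represented by 'I_n = {0, ..., n-1}. *)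

Definition uniform (n k : nat) (F : {set {set 'I_n}}) : Prop :=
  forall A : {set 'I_n}, A \in F -> #|A| = k.

(* A = B is allowed; this only excludes the empty set as a member, which
   k-uniformity with k > 0 already does. *)
Definition intersecting (n : nat) (F : {set {set 'I_n}}) : Prop :=
  forall A B : {set 'I_n}, A \in F -> B \in F -> A :&: B != set0.

Definition degree (n : nat) (F : {set {set 'I_n}}) (x : 'I_n) : nat :=
  #|[set A in F | x \in A]|.

Definition regular (n : nat) (F : {set {set 'I_n}}) : Prop :=
  forall x y : 'I_n, degree F x = degree F y.

(* Binomial coefficient with integer lower index, zero when that index is
   negative.  With ssrnat's truncated k - r the coefficient 'C(n - r, k - r)
   would wrongly be 1 for k < r. *)
Definition binz (m : nat) (j : int) : nat :=
  if j is Posz i then 'C(m, i) else 0.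

(* Main.v *)
(* Let h be the indicator of the up-closure of F. If the theorem fails, regularity shows
   that for every set J of bounded size at least half of F avoids J; comparing uniform and
   biased measures, the members of F avoiding J still have an up-closure of 1/4-biased
   measure at least 4^-(r+1). By Russo's formula and the mean value theorem, h has total
   influence at most 4 for some bias q in [1/4, 1/2]. Let J consist of the coordinates with
   non-negligible influence; hypercontractivity (as in Friedgut's junta theorem) shows that
   h is close to its conditional expectation given J. The latter is at least 4^-(r+1)
   everywhere, so it is close to 1 on average. Thus h has 1/2-biased measure above 1/2,
   and some set and its complement both contain members of F. *)
Require Import Defs.
From mathcomp Require Import all_boot all_order all_algebra.
From mathcomp Require Import reals.
From mathcomp Require Import zify ring lra.
From mathcomp Require Import polyrcf.
Import Order.TTheory GRing.Theory Num.Theory.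
Local Open Scope ring_scope.

Set Implicit Arguments.
Unset Strict Implicit.
Unset Printing Implicit Defensive.

(** * Expectations over independent biased bits *)

Section Expectation.
Variable R : comNzRingType.
Implicit Types (q : R) (f g : seq bool -> R) (n : nat) (s : seq bool).

(** Expectation of [f] under [n] independent bits, each true with probability [q]. A commutative
    ring is enough, so that [q] can also be a polynomial indeterminate, as in [Ex_poly]. *)
Fixpoint Ex q n f : R :=
  if n is m.+1 then
    q * Ex q m (fun s => f (true :: s)) + (1 - q) * Ex q m (fun s => f (false :: s))
  else f [::].

Lemma eq_Ex q n f g :
  (forall s, size s = n -> f s = g s) -> Ex q n f = Ex q n g.
Proof.
elim: n f g => [|n IH] f g fg /=; first exact: fg.
by congr (_ * _ + _ * _); apply: IH => s sn; apply: fg; rewrite /= sn.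
Qed.

Lemma ExD q n f g : Ex q n (fun s => f s + g s) = Ex q n f + Ex q n g.
Proof. by elim: n f g => [|n IH] f g //=; rewrite !IH; ring. Qed.

Lemma ExZ q n c f : Ex q n (fun s => c * f s) = c * Ex q n f.
Proof. by elim: n f => [|n IH] f //=; rewrite !IH; ring. Qed.

Lemma ExB q n f g : Ex q n (fun s => f s - g s) = Ex q n f - Ex q n g.
Proof. by elim: n f g => [|n IH] f g //=; rewrite !IH; ring. Qed.

Lemma Ex_cst q n c : Ex q n (fun=> c) = c.
Proof. by elim: n => [|n IH] //=; rewrite !IH; ring. Qed.

Lemma Ex_sum q n (I : Type) (r : seq I) (P : pred I) (F : I -> seq bool -> R) :
  Ex q n (fun s => \sum_(i <- r | P i) F i s) = \sum_(i <- r | P i) Ex q n (F i).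
Proof.
elim: r => [|i r IH].
  by under eq_Ex do rewrite big_nil; rewrite big_nil Ex_cst.
rewrite big_cons -IH; case: ifP => Pi; last by under eq_Ex do rewrite big_cons Pi.
by rewrite -ExD; under eq_Ex do rewrite big_cons Pi.
Qed.

Definition av q f s := q * f (true :: s) + (1 - q) * f (false :: s).

Definition df f s := f (true :: s) - f (false :: s).

Lemma ExS q n f : Ex q n.+1 f = Ex q n (av q f).
Proof. by rewrite /av ExD !ExZ. Qed.

(** Plancherel in one coordinate: the centred bit has mean 0 and variance [q * (1 - q)]. *)
Lemma ExMS q n f g : Ex q n.+1 (fun s => f s * g s) =
  Ex q n (fun s => av q f s * av q g s) +
  q * (1 - q) * Ex q n (fun s => df f s * df g s).
Proof.
by rewrite ExS -ExZ -ExD; apply: eq_Ex => s _; rewrite /av /df; ring.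
Qed.

Definition andS s t := [seq x.1 && x.2 | x <- zip s t].

Lemma Ex_and q q' n f :
  Ex (q * q') n f = Ex q n (fun s => Ex q' n (fun t => f (andS s t))).
Proof.
elim: n f => [|n IH] f //=; rewrite !ExD !ExZ.
rewrite -!(IH (fun s => f (_ :: s))); ring.
Qed.

Lemma Ex_eq q n t : size t = n ->
  Ex q n (fun s => (s == t)%:R) = q ^+ count id t * (1 - q) ^+ (n - count id t).
Proof.
move=> <-; elim: t => [|b t IH] /=; first by rewrite expr0 mulr1.
have cs : (count id t <= size t)%N by exact: count_size.
under eq_Ex do rewrite eqseq_cons.
under [X in _ + _ * X]eq_Ex do rewrite eqseq_cons.
case: b => /=; rewrite IH Ex_cst.
  by rewrite add1n subSS exprS; ring.
by rewrite add0n subSn// exprS; ring.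
Qed.

Lemma Ex_count q n : Ex q n (fun s => (count id s)%:R) = q * n%:R.
Proof.
elim: n => [|n IH] /=; first by rewrite mulr0.
under eq_Ex do rewrite natrD.
by rewrite ExD Ex_cst IH -(addn1 n) natrD /=; ring.
Qed.

(** Discrete derivative in coordinate [j]; for the indicator of an up-set its expectation is the
    influence of [j]. *)
Definition pd j f s := f (set_nth false s j true) - f (set_nth false s j false).

End Expectation.

(** * Positivity and the Cauchy-Schwarz inequality *)

Section Order.
Variable R : realFieldType.
Implicit Types (q : R) (f g : seq bool -> R) (n : nat) (s : seq bool).

Lemma le_Ex q n f g : 0 <= q <= 1 ->
  (forall s, size s = n -> f s <= g s) -> Ex q n f <= Ex q n g.
Proof.
move=> /andP[q0 q1]; elim: n f g => [|n IH] f g fg /=; first exact: fg.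
by apply: lerD; apply: ler_wpM2l; rewrite ?subr_ge0//;
  apply: IH => s sn; apply: fg; rewrite /= sn.
Qed.

Lemma Ex_ge0 q n f : 0 <= q <= 1 ->
  (forall s, size s = n -> 0 <= f s) -> 0 <= Ex q n f.
Proof. by move=> q01 f0; rewrite -(Ex_cst q n 0) le_Ex. Qed.

Lemma discr_le (a b c : R) : 0 <= a ->
  (forall t, 0 <= a * t ^+ 2 - 2 * b * t + c) -> b ^+ 2 <= a * c.
Proof.
rewrite le_eqVlt => /predU1P[<-|a_gt0] H.
  have [->|b0] := eqVneq b 0; first by rewrite expr0n/= mul0r.
  (* With leading coefficient 0 the form is affine in [t], and this [t] gives it the value -1. *)
  have := H ((c + 1) / (2 * b)).
  have -> : 0 * ((c + 1) / (2 * b)) ^+ 2 - 2 * b * ((c + 1) / (2 * b)) + c = -1.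
    by field.
  lra.
(* The minimum of the quadratic is attained at [b / a]. *)
have := H (b / a).
have -> : a * (b / a) ^+ 2 - 2 * b * (b / a) + c = (a * c - b ^+ 2) / a.
  by field; rewrite gt_eqF.
by rewrite pmulr_lge0 ?invr_gt0// subr_ge0.
Qed.

Lemma Ex_CauchySchwarz q n f g : 0 <= q <= 1 ->
  Ex q n (fun s => f s * g s) ^+ 2 <=
  Ex q n (fun s => f s ^+ 2) * Ex q n (fun s => g s ^+ 2).
Proof.
move=> q01; apply: discr_le => [|t]; first by apply: Ex_ge0 => // s _; exact: sqr_ge0.
have : 0 <= Ex q n (fun s => (t * f s - g s) ^+ 2).
  by apply: Ex_ge0 => // s _; exact: sqr_ge0.
congr (_ <= _); rewrite mulrC -mulrA (mulrC _ t) mulrA -!ExZ -ExB -ExD.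
by apply: eq_Ex => s _; ring.
Qed.

End Order.

(** * The noise operator and weighted Fourier sums *)

Section Noise.
Variables (R : comNzRingType) (q : R).
Implicit Types (f g : seq bool -> R) (n : nat) (s S : seq bool).
Local Notation av := (av q).
Local Notation Ex := (Ex q).
Local Notation v := (q * (1 - q)).

(* Writing x - q for the centred coordinate, f (x :: s) = av f s + (x - q) * df f s;
   the noise operator scales the second part by the rate of the coordinate. *)
Fixpoint noise (rs : seq R) f s : R :=
  if rs is r :: rs' then
    noise rs' (av f) (behead s) +
    r * ((head false s)%:R - q) * noise rs' (df f) (behead s)
  else f [::].

Lemma eq_noise rs f g : f =1 g -> noise rs f =1 noise rs g.
Proof.
elim: rs f g => [|r rs IH] f g fg s /=; first exact: fg.
by congr (_ + _ * _); apply: IH => t; rewrite /av /df !fg.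
Qed.

Lemma noise_lin rs a b f g s :
  noise rs (fun t => a * f t + b * g t) s = a * noise rs f s + b * noise rs g s.
Proof.
elim: rs f g s => [|r rs IH] f g s //=.
rewrite (@eq_noise _ _ (fun t => a * av f t + b * av g t)); last first.
  by move=> t; rewrite /av; ring.
rewrite (@eq_noise _ (df _) (fun t => a * df f t + b * df g t)); last first.
  by move=> t; rewrite /df; ring.
by rewrite !IH; ring.
Qed.

Lemma av_noise r rs f s : av (noise (r :: rs) f) s = noise rs (av f) s.
Proof. by rewrite /av /=; ring. Qed.

Lemma df_noise r rs f s : df (noise (r :: rs) f) s = r * noise rs (df f) s.
Proof. by rewrite /df /=; ring. Qed.

(** The operator is diagonal in the decomposition of [ExMS], hence self-adjoint. *)
Lemma noise_sym n rs f g : size rs = n ->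
  Ex n (fun s => f s * noise rs g s) = Ex n (fun s => noise rs f s * g s).
Proof.
move=> <- {n}; elim: rs f g => [|r rs IH] f g //; rewrite [size _]/= !ExMS.
under eq_Ex do rewrite av_noise.
under [in RHS]eq_Ex do rewrite av_noise.
rewrite IH; congr (_ + _ * _).
under eq_Ex do rewrite df_noise mulrCA.
under [in RHS]eq_Ex do rewrite df_noise -mulrA.
by rewrite !ExZ IH.
Qed.

(* The sum of c S * v ^ #|S| * (Fourier coefficient of f at S) ^ 2, with S given by
   its indicator sequence. *)
Fixpoint wsum (c : seq bool -> R) n f : R :=
  if n is m.+1 then
    wsum (fun S => c (false :: S)) m (av f) + v * wsum (fun S => c (true :: S)) m (df f)
  else c [::] * f [::] ^+ 2.

Lemma eq_wsum c c' n f g : (forall S, size S = n -> c S = c' S) -> f =1 g ->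
  wsum c n f = wsum c' n g.
Proof.
elim: n c c' f g => [|n IH] c c' f g cc fg /=; first by rewrite cc// fg.
by congr (_ + _ * _); apply: IH => [S Sn|t]; rewrite ?cc/= ?Sn// /av /df !fg.
Qed.

Lemma wsumD c c' n f : wsum (fun S => c S + c' S) n f = wsum c n f + wsum c' n f.
Proof. by elim: n c c' f => [|n IH] c c' f /=; rewrite ?IH; ring. Qed.

Lemma wsumZ a c n f : wsum (fun S => a * c S) n f = a * wsum c n f.
Proof. by elim: n c f => [|n IH] c f /=; rewrite ?IH; ring. Qed.

Lemma wsum0 n f : wsum (fun=> 0) n f = 0.
Proof. by elim: n f => [|n IH] f /=; rewrite ?IH; ring. Qed.

Lemma wsum_f0 c n : wsum c n (fun=> 0) = 0.
Proof.
elim: n c => [|n IH] c /=; first by ring.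
rewrite (@eq_wsum _ (fun S => c (false :: S)) _ _ (fun=> 0))//; last first.
  by move=> t; rewrite /av; ring.
rewrite (@eq_wsum _ (fun S => c (true :: S)) _ (df _) (fun=> 0))//; last first.
  by move=> t; rewrite /df; ring.
by rewrite !IH; ring.
Qed.

Lemma wsum_sum n f (I : Type) (r : seq I) (P : pred I) (c : I -> seq bool -> R) :
  wsum (fun S => \sum_(i <- r | P i) c i S) n f = \sum_(i <- r | P i) wsum (c i) n f.
Proof.
elim: r => [|i r IH].
  rewrite big_nil -[RHS](wsum0 n f); apply: eq_wsum => // S _; exact: big_nil.
rewrite big_cons -IH; case: ifP => Pi.
  by rewrite -wsumD; apply: eq_wsum => // S _; rewrite big_cons Pi.
by apply: eq_wsum => // S _; rewrite big_cons Pi.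
Qed.

(** The squared eigenvalue of [noise rs] at the Fourier character of [S]. *)
Fixpoint rate_prod (rs : seq R) S : R :=
  if rs is r :: rs' then (if head false S then r ^+ 2 else 1) * rate_prod rs' (behead S)
  else 1.

Lemma Ex_sqr_noise n rs f : size rs = n ->
  Ex n (fun s => noise rs f s ^+ 2) = wsum (rate_prod rs) n f.
Proof.
move=> <- {n}; elim: rs f => [|r rs IH] f; first by rewrite /= mul1r.
under eq_Ex do rewrite expr2.
rewrite [size _]/= ExMS.
under eq_Ex do rewrite av_noise -expr2.
under [X in _ + _ * X]eq_Ex do rewrite df_noise -expr2 exprMn.
rewrite ExZ !IH /= -wsumZ; congr (_ + _ * _).
by apply: eq_wsum => // S _; rewrite mul1r.
Qed.

Lemma Ex_sqr n f : Ex n (fun s => f s ^+ 2) = wsum (fun=> 1) n f.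
Proof.
elim: n f => [|n IH] f; first by rewrite /= mul1r.
by under eq_Ex do rewrite expr2; rewrite ExMS /= -!IH.
Qed.

(** Differentiating in coordinate [j] keeps exactly the Fourier sets containing [j] and deletes [j]
    from them; the factor [v] makes up for the lost element. *)
Lemma wsum_pd c n j f : (j < n)%N ->
  v * wsum c n (pd j f) =
  wsum (fun S => (nth false S j)%:R * c (set_nth false S j false)) n f.
Proof.
elim: n j c f => [|n IH] [|j] c f //= jn.
  rewrite (@eq_wsum _ (fun S => c (false :: S)) _ _ (df f))//; last first.
    by move=> t; rewrite /av /pd /df /=; ring.
  rewrite (@eq_wsum _ (fun S => c (true :: S)) _ (df (pd 0 f)) (fun=> 0))//; last first.
    by move=> t; rewrite /pd /df /=; ring.
  rewrite wsum_f0 wsumZ mul0r add0r mulr0 addr0; congr (_ * _).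
  by apply: eq_wsum => // S _; rewrite mul1r.
rewrite mulrDr (@eq_wsum _ (fun S => c (false :: S)) _ _ (pd j (av f)))//; last first.
  by move=> t; rewrite /av /pd /=; ring.
rewrite (@eq_wsum _ (fun S => c (true :: S)) _ (df (pd j.+1 f)) (pd j (df f)))//; last first.
  by move=> t; rewrite /pd /df /=; ring.
by rewrite !IH.
Qed.

End Noise.

(** * Hypercontractivity for biases between 1/4 and 1/2 *)

Section Hypercontractivity.
Variables (R : realFieldType) (q : R).
Hypothesis q_itv : 1 / 4 <= q <= 1 / 2.
Implicit Types (f g : seq bool -> R) (n : nat) (s S : seq bool).
Local Notation Ex := (Ex q).
Local Notation noise := (noise q).
Local Notation v := (q * (1 - q)).

Let q01 : 0 <= q <= 1. Proof. by case/andP: q_itv => *; apply/andP; split; lra. Qed.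
Let v_ge : 3 / 16 <= v.
Proof.
have /andP[q1 q2] := q_itv.
have : 0 <= (q - 1 / 4) * (1 / 2 - q) by rewrite mulr_ge0// subr_ge0.
lra.
Qed.

(* The right-hand side is (a ^+ 2 + v * b ^+ 2) ^+ 2; the difference is
   v b^2 ((a - (1 - 2q) b / 2)^2 / 2 + c b^2) with c > 0. *)
Lemma two_point (a b : R) :
  q * (a + (1 - q) * b / 2) ^+ 4 + (1 - q) * (a - q * b / 2) ^+ 4 <=
  a ^+ 4 + 2 * v * (a ^+ 2 * b ^+ 2) + v ^+ 2 * b ^+ 4.
Proof.
rewrite -subr_ge0.
have -> : a ^+ 4 + 2 * v * (a ^+ 2 * b ^+ 2) + v ^+ 2 * b ^+ 4 -
    (q * (a + (1 - q) * b / 2) ^+ 4 + (1 - q) * (a - q * b / 2) ^+ 4) =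
  v * b ^+ 2 * ((a - (1 - 2 * q) * b / 2) ^+ 2 / 2 + (27 * v - 3) / 16 * b ^+ 2).
  by field.
have v0 : 0 <= v by have := v_ge; lra.
apply: mulr_ge0; first by rewrite mulr_ge0 ?sqr_ge0.
by apply: addr_ge0; apply: mulr_ge0; rewrite ?sqr_ge0//; have := v_ge; lra.
Qed.

(** Bonami's induction on the number of coordinates: [two_point] treats the first one pointwise, and
    Cauchy-Schwarz bounds the mixed term it produces. *)
Lemma noise_hypercontractive n f :
  Ex n (fun s => noise (nseq n (1 / 2)) f s ^+ 4) <= Ex n (fun s => f s ^+ 2) ^+ 2.
Proof.
elim: n f => [|n IH] f; first by rewrite /= -exprM.
set a := noise (nseq n (1 / 2)) (av q f); set b := noise (nseq n (1 / 2)) (df f).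
have -> : Ex n.+1 (fun s => f s ^+ 2) =
    Ex n (fun s => av q f s ^+ 2) + v * Ex n (fun s => df f s ^+ 2).
  by under eq_Ex do rewrite expr2; rewrite ExMS.
set A := Ex n (fun s => av q f s ^+ 2); set B := Ex n (fun s => df f s ^+ 2).
have A0 : 0 <= A by apply: Ex_ge0 => // s _; exact: sqr_ge0.
have B0 : 0 <= B by apply: Ex_ge0 => // s _; exact: sqr_ge0.
have ab : Ex n (fun s => a s ^+ 2 * b s ^+ 2) <= A * B.
  rewrite -(ler_pXn2r (ltn0Sn 1)) ?nnegrE ?mulr_ge0//; last first.
    by apply: Ex_ge0 => // s _; rewrite mulr_ge0 ?sqr_ge0.
  apply: le_trans (Ex_CauchySchwarz _ _ _ q01) _; rewrite exprMn.
  under eq_Ex do rewrite -exprM.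
  under [X in _ * X]eq_Ex do rewrite -exprM.
  by apply: ler_pM; rewrite ?IH//; apply: Ex_ge0 => // s _;
    rewrite exprM sqr_ge0.
apply: (@le_trans _ _ (Ex n (fun s => a s ^+ 4 + 2 * v * (a s ^+ 2 * b s ^+ 2)
    + v ^+ 2 * b s ^+ 4))).
  rewrite ExS; apply: le_Ex => // s _; apply: le_trans (two_point (a s) (b s)).
  by rewrite le_eqVlt; apply/orP; left; apply/eqP; rewrite /av /= /a /b; field.
rewrite !ExD !ExZ.
have -> : (A + v * B) ^+ 2 = A ^+ 2 + 2 * v * (A * B) + v ^+ 2 * B ^+ 2 by ring.
apply: lerD; [apply: lerD; first exact: IH|].
- by rewrite ler_wpM2l//; have := v_ge; lra.
- by rewrite ler_wpM2l ?sqr_ge0//; exact: IH.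
Qed.

(** The dual (4/3, 2) bound for a 0/1-valued [g], without fractional norms. Self-adjointness gives X
    = E[g h] with h = T T g; Cauchy-Schwarz gives X^2 <= I Y and Y^2 <= I E[h^4] <= I X^2, where Y =
    E[g h^2]. Hence X^4 <= I^3 X^2. *)
Lemma noise_indicator n g : (forall s, size s = n -> g s ^+ 2 = g s) ->
  Ex n (fun s => noise (nseq n (1 / 2)) g s ^+ 2) ^+ 2 <= Ex n g ^+ 3.
Proof.
move=> gg; set X := Ex n _; set I := Ex n g; set T := noise (nseq n (1 / 2)).
have X0 : 0 <= X by apply: Ex_ge0 => // s _; exact: sqr_ge0.
have I0 : 0 <= I by apply: Ex_ge0 => // s /gg <-; exact: sqr_ge0.
have I2 : Ex n (fun s => g s ^+ 2) = I by apply: eq_Ex.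
set h := T (T g).
have XE : X = Ex n (fun s => g s * (g s * h s)).
  rewrite /X; under eq_Ex do rewrite expr2.
  rewrite -noise_sym ?size_nseq//; apply: eq_Ex => s /gg sn.
  by rewrite mulrA -expr2 sn.
have X2 : X ^+ 2 <= I * Ex n (fun s => g s * h s ^+ 2).
  rewrite XE; apply: le_trans (Ex_CauchySchwarz _ _ _ q01) _.
  rewrite I2 le_eqVlt; apply/orP; left; apply/eqP; congr (_ * _).
  by apply: eq_Ex => s /gg sn; rewrite exprMn sn.
have Y2 : Ex n (fun s => g s * h s ^+ 2) ^+ 2 <= I * X ^+ 2.
  apply: le_trans (Ex_CauchySchwarz _ _ _ q01) _; rewrite I2 ler_wpM2l//.
  by under eq_Ex do rewrite -exprM; exact: noise_hypercontractive.
set Y := Ex n (fun s => g s * h s ^+ 2) in X2 Y2.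
have [X00|X_neq0] := eqVneq X 0; first by rewrite X00 expr0n exprn_ge0.
have X_gt0 : 0 < X ^+ 2 by rewrite exprn_gt0// lt_def X_neq0.
rewrite -(ler_pM2r X_gt0).
apply: (@le_trans _ _ ((I * Y) ^+ 2)).
  rewrite -expr2 ler_pXn2r ?nnegrE ?sqr_ge0//.
  exact: le_trans (sqr_ge0 _) X2.
rewrite exprMn.
have -> : I ^+ 3 * X ^+ 2 = I ^+ 2 * (I * X ^+ 2) by ring.
by rewrite ler_wpM2l ?sqr_ge0.
Qed.

End Hypercontractivity.

(** * Monotone functions and conditional expectations *)

Section Monotone.
Variables (R : realFieldType) (q : R).
Hypothesis q01 : 0 <= q <= 1.
Implicit Types (f g : seq bool -> R) (n : nat) (s t S m : seq bool).

(** Inclusion of supports; sequences count as padded with [false], so lengths may differ. *)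
Definition les s t := forall i, nth false s i -> nth false t i.

Definition mono f := forall s t, les s t -> f s <= f t.

Lemma les_cons (b c : bool) s t : (b -> c) -> les s t -> les (b :: s) (c :: t).
Proof. by move=> bc st [|i] //=; exact: st. Qed.

Lemma nth_andS s t i : nth false (andS s t) i = nth false s i && nth false t i.
Proof.
by rewrite /andS; elim: s t i => [|a s IH] [|b t] [|i] //=; rewrite ?andbF ?IH.
Qed.

Lemma mono_cons b f : mono f -> mono (fun s => f (b :: s)).
Proof. by move=> mf s t st; apply: mf; apply: les_cons. Qed.

Lemma mono_av f : mono f -> mono (av q f).
Proof.
move=> mf s t st; case/andP: q01 => q0 q1.
by apply: lerD; apply: ler_wpM2l; rewrite ?subr_ge0//; apply: mf; apply: les_cons.
Qed.

Definition restr m f s := f (andS s (map negb m)).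

(* With rate 1 on the coordinates of m and 0 elsewhere, the noise operator is the
   conditional expectation given the coordinates of m. *)
Definition condE m f := noise q [seq (b : bool)%:R | b <- m] f.

Lemma condE_cons b m f s : condE (b :: m) f s =
  condE m (if b then fun t => f (head false s :: t) else av q f) (behead s).
Proof.
rewrite /condE /=; case: b => /=; last by rewrite mul0r mul0r addr0.
rewrite mul1r -[X in X + _]mul1r -noise_lin; apply: eq_noise => u.
by rewrite /av /df; case: (head false s) => /=; ring.
Qed.

(** For monotone [f], the conditional expectation is smallest when all coordinates of [m] are
    false. *)
Lemma Ex_restr_le_condE m f s : mono f -> Ex q (size m) (restr m f) <= condE m f s.
Proof.
elim: m f s => [|b m IH] f s mf //; rewrite condE_cons.
case: b => /=.
  apply: le_trans (IH _ _ (mono_cons _ mf)).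
  (* The head is forced to [false] in both branches, so the weights [q] and [1 - q] add up to 1. *)
  rewrite -mulrDl addrC subrK mul1r; apply: le_Ex => // u _; apply: mf.
  by apply: les_cons.
apply: le_trans (IH _ _ (mono_av mf)).
by rewrite -!ExZ -ExD; apply: le_Ex => // u _.
Qed.

Lemma condE_le m f s c : (forall t, f t <= c) -> condE m f s <= c.
Proof.
elim: m f s => [|b m IH] f s fc; first exact: fc.
rewrite condE_cons; apply: IH => t; case: b => //.
have -> : c = q * c + (1 - q) * c by ring.
by case/andP: q01 => q0 q1; apply: lerD; apply: ler_wpM2l; rewrite ?subr_ge0.
Qed.

Lemma Ex_condE m f : Ex q (size m) (condE m f) = Ex q (size m) f.
Proof.
elim: m f => [|b m IH] f //; rewrite [size _]/= !ExS /condE.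
by under eq_Ex do rewrite [map _ _]/= av_noise; exact: IH.
Qed.

Lemma Ex_condE_sqr m f :
  Ex q (size m) (fun s => condE m f s ^+ 2) =
  wsum q (rate_prod [seq (b : bool)%:R | b <- m]) (size m) f.
Proof. by rewrite /condE Ex_sqr_noise ?size_map. Qed.

Lemma le_wsum c c' n f : (forall S, size S = n -> c S <= c' S) ->
  wsum q c n f <= wsum q c' n f.
Proof.
case/andP: q01 => q0 q1; elim: n c c' f => [|n IH] c c' f cc /=.
  by rewrite ler_wpM2r ?sqr_ge0 ?cc.
apply: lerD; first by apply: IH => S Sn; rewrite cc/= ?Sn.
by rewrite ler_wpM2l ?mulr_ge0 ?subr_ge0//; apply: IH => S Sn; rewrite cc/= ?Sn.
Qed.

Lemma rate_prod_nseq (r : R) n S : size S = n ->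
  rate_prod (nseq n r) S = r ^+ (2 * count id S).
Proof.
move=> <-; elim: S => [|b S IH] //=; rewrite IH mulnDr exprD.
by case: b => //=.
Qed.

Lemma rate_prod_mask m S : size S = size m ->
  rate_prod [seq (b : bool)%:R | b <- m] S =
  ([forall j : 'I_(size m), nth false S j ==> nth false m j])%:R :> R.
Proof.
move=> Sm.
suff -> : [forall j : 'I_(size m), nth false S j ==> nth false m j] =
    all (fun x => x.1 ==> x.2) (zip S m).
  elim: S m Sm => [|a S IH] [|b m] //= [Sm]; rewrite IH//.
  by case: a b => [] [] /=; rewrite ?expr0n ?expr1n /= ?mul0r ?mul1r.
apply/forallP/(all_nthP (false, false)) => [H i|H i].
  rewrite size_zip Sm minnn => im; rewrite nth_zip//=; exact: (H (Ordinal im)).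
by have := H i; rewrite size_zip Sm minnn ltn_ord nth_zip//=; exact.
Qed.

Lemma count_sum n S : size S = n -> count id S = (\sum_(j < n) nth false S j)%N.
Proof.
move=> <-; elim: S => [|b S IH] /=; first by rewrite big_ord0.
by rewrite big_ord_recl /= IH.
Qed.

Lemma count_set_nth S j : nth false S j ->
  count id S = (count id (set_nth false S j false)).+1.
Proof.
elim: S j => [|b S IH] [|j] //=; first by move=> ->.
by move=> /IH ->; rewrite addnS.
Qed.

(* A Fourier set S outside m is charged to the total influence if #|S| >= d, and to
   the noisy influence of one of its elements outside m otherwise. *)
Lemma weight_le m d S : (0 < d)%N -> size S = size m ->
  1 - rate_prod [seq (b : bool)%:R | b <- m] S <=
  d%:R^-1 * (\sum_(j < size m) (nth false S j)%:R) +
  4 ^+ d * (\sum_(j < size m | ~~ nth false m j)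
    (nth false S j)%:R * rate_prod (nseq (size m) (1 / 2)) (set_nth false S j false))
  :> R.
Proof.
move=> d0 Sm; rewrite rate_prod_mask//.
have rp0 S' : 0 <= rate_prod (nseq (size m) (1 / 2)) S' :> R.
  elim: (size m) S' => [|k IH] S' //=; rewrite mulr_ge0//.
  by case: ifP => // _; exact: sqr_ge0.
have s0 (P : pred 'I_(size m)) : 0 <= \sum_(j < size m | P j)
    (nth false S j)%:R * rate_prod (nseq (size m) (1 / 2)) (set_nth false S j false) :> R.
  by apply: sumr_ge0 => j _; rewrite mulr_ge0.
have t0 : 0 <= \sum_(j < size m) (nth false S j)%:R :> R by apply: sumr_ge0.
have dV : 0 <= d%:R^-1 :> R by rewrite invr_ge0.
case: forallP => [_|/forallP].
  by rewrite subrr addr_ge0 ?mulr_ge0 ?exprn_ge0.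
rewrite negb_forall => /existsP[j]; rewrite negb_imply => /andP[Sj mj].
rewrite subr0; have [dS|Sd] := leqP d (count id S).
  rewrite -[leLHS]addr0; apply: lerD; last by rewrite mulr_ge0 ?exprn_ge0.
  rewrite -natr_sum -count_sum// mulrC ler_pdivlMr ?ltr0n//.
  by rewrite mul1r ler_nat.
rewrite -[leLHS]add0r; apply: lerD; first by rewrite mulr_ge0.
rewrite (bigD1 j)//= Sj [true%:R * _]mul1r.
have szj : size (set_nth false S j false) = size m.
  by rewrite size_set_nth Sm; apply/maxn_idPr.
rewrite rate_prod_nseq// mulrDr.
(* Fewer than [d] elements remain, each costing a factor 1/4, so [4 ^+ d] compensates; the other
   summands are nonnegative. *)
apply: (@le_trans _ _ (4 ^+ d * (1 / 2) ^+ (2 * count id (set_nth false S j false)))).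
  rewrite exprM.
  have -> : (1 / 2) ^+ 2 = 4^-1 :> R by field.
  rewrite exprVn ler_pdivlMr ?exprn_gt0// mul1r.
  rewrite ler_weXn2l ?ler1n// ltnW//.
  by move: Sd; rewrite (count_set_nth Sj) => /ltnW.
by rewrite lerDl mulr_ge0 ?exprn_ge0.
Qed.

End Monotone.

(** * Biased measures of up-sets: Russo's formula, change of bias, juntas *)

Section Threshold.
Variable R : rcfType.
Implicit Types (q : R) (f g : seq bool -> R) (n : nat) (s t S m : seq bool).

Definition Ex_poly n f : {poly R} := Ex 'X n (fun s => (f s)%:P).

Lemma horner_Ex_poly n f q : (Ex_poly n f).[q] = Ex q n f.
Proof.
rewrite /Ex_poly; elim: n f => [|n IH] f /=; first by rewrite hornerC.
by rewrite !hornerE !IH.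
Qed.

Lemma Ex_pd0 q n f : Ex q n.+1 (pd 0 f) =
  Ex q n (fun s => f (true :: s)) - Ex q n (fun s => f (false :: s)).
Proof. by rewrite ExS -ExB; apply: eq_Ex => s _; rewrite /av /pd /=; ring. Qed.

(** Product rule on the recursion of [Ex]: differentiating the weights of the first bit gives its
    influence, differentiating the two branches gives the remaining ones. *)
Lemma Russo_formula n f q :
  (Ex_poly n f)^`().[q] = \sum_(j < n) Ex q n (pd j f).
Proof.
elim: n f => [|n IH] f; first by rewrite /Ex_poly /= derivC hornerC big_ord0.
rewrite big_ord_recl Ex_pd0 /Ex_poly /=.
rewrite -!/(Ex_poly n (fun s => f (_ :: s))) !derivE !hornerE !IH !horner_Ex_poly.
rewrite big_split /= -!mulr_sumr /pd /=; ring.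
Qed.

Lemma Ex_half_negb n f :
  Ex (1 / 2) n (fun s => f (map negb s)) = Ex (1 / 2) n f.
Proof.
elim: n f => [|n IH] f //=.
rewrite (IH (fun s => f (false :: s))) (IH (fun s => f (true :: s))).
by have -> : 1 - 1 / 2 = 1 / 2 :> R; [lra | rewrite addrC].
Qed.

Definition ind (h : pred (seq bool)) s : R := (h s)%:R.

Definition upset (h : pred (seq bool)) := forall s t, les s t -> h s -> h t.

Variable h : pred (seq bool).
Hypothesis h_up : upset h.

Lemma ind_ge0 s : 0 <= ind h s. Proof. exact: ler0n. Qed.

Lemma ind_le1 s : ind h s <= 1. Proof. by rewrite /ind; case: (h s). Qed.

Lemma ind_sqr s : ind h s ^+ 2 = ind h s.
Proof. by rewrite /ind; case: (h s); rewrite ?expr1n ?expr0n. Qed.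

Lemma mono_ind : mono (ind h).
Proof. by move=> s t /h_up; rewrite /ind; case: (h s) => [->|]. Qed.

Lemma les_set_nth s j : les (set_nth false s j false) (set_nth false s j true).
Proof. by move=> i; rewrite !nth_set_nth /=; case: eqP. Qed.

Lemma pd_sqr j s : pd j (ind h) s ^+ 2 = pd j (ind h) s.
Proof.
rewrite /pd /ind; have := @h_up _ _ (@les_set_nth s j).
case: (h _) => [->|_] //; first by rewrite subrr expr0n.
by case: (h _); rewrite subr0 ?expr1n ?expr0n.
Qed.

Lemma les_andl s t : les (andS s t) s.
Proof. by move=> i; rewrite nth_andS => /andP[]. Qed.

Lemma les_andr s t : les (andS s t) t.
Proof. by move=> i; rewrite nth_andS => /andP[]. Qed.

Lemma Ex_ind_le1 q n : 0 <= q <= 1 -> Ex q n (ind h) <= 1.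
Proof. by move=> q01; rewrite -[leRHS](Ex_cst q n) le_Ex// => s _; exact: ind_le1. Qed.

(* An ab-biased random set is the intersection of independent a- and b-biased ones. *)
Lemma Ex_mul_le a b n : 0 <= a <= 1 -> 0 <= b <= 1 ->
  Ex (a * b) n (ind h) <= Ex a n (ind h) * Ex b n (ind h).
Proof.
move=> a01 b01; rewrite Ex_and mulrC -ExZ; apply: le_Ex => // s _.
rewrite mulrC -ExZ; apply: le_Ex => // t _.
have := @h_up _ _ (@les_andl s t); have := @h_up _ _ (@les_andr s t).
rewrite /ind; case: (h (andS s t)) => [-> // ->//|_ _]; first by rewrite mulr1.
by rewrite mulr_ge0.
Qed.

Lemma Ex_exp_le a n (t : nat) : 0 <= a <= 1 ->
  Ex (a ^+ t) n (ind h) <= Ex a n (ind h) ^+ t.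
Proof.
move=> a01; have /andP[a0 a1] := a01; elim: t => [|t IH].
  by rewrite expr0 Ex_ind_le1// lexx ler01.
rewrite !exprS; apply: le_trans (Ex_mul_le _ _ _) _ => //.
  by rewrite exprn_ge0// exprn_ile1.
by rewrite ler_wpM2l// Ex_ge0// => s _; exact: ind_ge0.
Qed.

(** Apply [Ex_mul_le] to [a = b * (a / b)] and bound the second factor by 1. *)
Lemma Ex_le_bias a b n : 0 <= a <= b -> b <= 1 ->
  Ex a n (ind h) <= Ex b n (ind h).
Proof.
move=> /andP[a0 ab] b1; have [b0|b_neq0] := eqVneq b 0.
  by have -> : a = b by apply/le_anti; rewrite ab b0.
have b_gt0 : 0 < b by rewrite lt_def b_neq0 (le_trans a0).
have c01 : 0 <= a / b <= 1.
  by rewrite divr_ge0 ?(ltW b_gt0)//= ler_pdivrMr// mul1r.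
have b01 : 0 <= b <= 1 by rewrite (ltW b_gt0).
have -> : a = b * (a / b) by field.
apply: le_trans (Ex_mul_le _ _ _) _ => //.
by rewrite ler_piMr ?Ex_ind_le1// Ex_ge0// => s _; exact: ind_ge0.
Qed.

(** The left side is the mean conditional variance given [m], that is, the Fourier weight on sets
    not inside [m]. By [weight_le] the total influence pays [K / d] for the large sets, and the
    noisy influences outside [m] pay for the small ones. *)
Lemma Ex_condVar_le q m d (e K : R) : 1 / 4 <= q <= 1 / 2 -> (0 < d)%N -> 0 <= e ->
  \sum_(j < size m) Ex q (size m) (pd j (ind h)) <= K ->
  (forall j, (j < size m)%N -> ~~ nth false m j ->
     Ex q (size m) (pd j (ind h)) <= e ^+ 2) ->
  Ex q (size m) (ind h) - Ex q (size m) (fun s => condE q m (ind h) s ^+ 2) <=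
  K / d%:R + 4 ^+ d * e * K.
Proof.
move=> q_itv d0 e0 IK Ie; set n := size m in IK Ie *.
have q01 : 0 <= q <= 1 by case/andP: q_itv => *; apply/andP; split; lra.
have v01 : 0 <= q * (1 - q) <= 1.
  by case/andP: q01 => *; apply/andP; split; nra.
have I_ge0 j : 0 <= Ex q n (pd j (ind h)).
  by apply: Ex_ge0 => // s _; rewrite -pd_sqr sqr_ge0.
have -> : Ex q n (ind h) = wsum q (fun=> 1) n (ind h).
  by rewrite -Ex_sqr; apply: eq_Ex => s _; rewrite ind_sqr.
pose c := @rate_prod R [seq (b : bool)%:R | b <- m].
have -> : wsum q (fun=> 1) n (ind h) =
    wsum q (fun S => 1 - c S) n (ind h) + wsum q c n (ind h).
  by rewrite -wsumD; apply: eq_wsum => // S _; rewrite subrK.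
rewrite Ex_condE_sqr addrK.
apply: le_trans (@le_wsum _ _ q01 _ _ n _ (fun S => @weight_le R m d S d0)) _.
rewrite wsumD !wsumZ !wsum_sum; apply: lerD.
  rewrite mulrC ler_pM2r ?invr_gt0 ?ltr0n//; apply: le_trans IK.
  apply: ler_sum => j _.
  rewrite (@eq_wsum _ _ _ (fun S => (nth false S j)%:R * 1) _ _ (ind h))//; last first.
    by move=> S _; rewrite mulr1.
  rewrite -(wsum_pd _ (fun=> 1))// -Ex_sqr.
  under eq_Ex do rewrite pd_sqr.
  by case/andP: v01 => *; rewrite ler_piMl.
rewrite -mulrA ler_wpM2l ?exprn_ge0//.
apply: (@le_trans _ _ (\sum_(j < n | ~~ nth false m j) e * Ex q n (pd j (ind h)))).
  apply: ler_sum => j mj; rewrite -wsum_pd// -Ex_sqr_noise ?size_nseq//.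
  set X := Ex _ _ _; have X0 : 0 <= X by apply: Ex_ge0 => // s _; exact: sqr_ge0.
  apply: (@le_trans _ _ X); first by case/andP: v01 => *; rewrite ler_piMl.
  (* With I the influence of [j], hypercontractivity gives X^2 <= I^3 <= (e I)^2, because I <=
     e^2. *)
  rewrite -(ler_pXn2r (ltn0Sn 1)) ?nnegrE ?mulr_ge0//.
  apply: le_trans (noise_indicator q_itv _) _; first by move=> s _; exact: pd_sqr.
  by rewrite exprSr mulrC exprMn ler_wpM2r ?sqr_ge0// Ie.
rewrite -mulr_sumr ler_wpM2l//; apply: le_trans IK.
by rewrite [leRHS](bigID (fun j : 'I_n => nth false m j))/= lerDr sumr_ge0.
Qed.

Lemma upset_restr m : upset (fun s => h (andS s (map negb m))).
Proof.
move=> s t st; apply: h_up => i; rewrite !nth_andS => /andP[/st -> ->].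
by [].
Qed.

End Threshold.

(** * Up-sets that stay large after deleting any small core *)

Section Uncapturable.
Variable R : rcfType.
Implicit Types (h : pred (seq bool)) (m s : seq bool).

(** This is d 4^d for d = 32 e: with K = 4 and inverse [noise_cst e] as the small parameter, both
    error terms of [Ex_condVar_le] equal 1 / (8 e). *)
Definition noise_cst (e : nat) := (32 * e * 4 ^ (32 * e))%N.

(** With total influence at most 4, at most 4 M^2 coordinates have influence above M^-2, for M =
    [noise_cst e]. *)
Definition core_size (e : nat) := (4 * noise_cst e ^ 2)%N.

(** Markov's inequality for the counting measure. *)
Lemma count_mkseq_le (n : nat) (F : nat -> R) (c : R) :
  (forall j, 0 <= F j) -> 0 <= c ->
  c * (count id (mkseq (fun j => c < F j) n))%:R <= \sum_(j < n) F j.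
Proof.
move=> F0 c0; rewrite (@count_sum n) ?size_mkseq// natr_sum mulr_sumr.
by apply: ler_sum => j _; rewrite nth_mkseq//; case: ltP => [/ltW|]; rewrite ?mulr1 ?mulr0.
Qed.

(* The mean value theorem provides a bias q with total influence at most 4; the core
   is the set of coordinates whose influence at q is not tiny. *)
Lemma uncapturable_majority (e n : nat) h : (0 < e)%N -> upset h ->
  (forall m, size m = n -> (count id m <= core_size e)%N ->
     e%:R^-1 <= Ex (1 / 4) n (ind R (fun s => h (andS s (map negb m))))) ->
  1 / 2 < Ex (1 / 2 : R) n (ind R h).
Proof.
move=> e0 h_up unc; set d := (32 * e)%N; set M := noise_cst e.
have M0 : (0 < M)%N by rewrite /M /noise_cst !muln_gt0 e0 expn_gt0.
have MR : 0 < M%:R :> R by rewrite ltr0n.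
have eR : 0 < e%:R :> R by rewrite ltr0n.
have lt42 : (1 / 4 < 1 / 2 :> R) by lra.
have [q /itvP q_itv qE] := poly_mvt (Ex_poly n (ind R h)) lt42.
have {}q_itv : 1 / 4 <= q <= 1 / 2 by rewrite !q_itv.
have q01 : 0 <= q <= 1 by case/andP: q_itv => *; apply/andP; split; lra.
rewrite Russo_formula !horner_Ex_poly in qE.
have h2 : 0 <= (1 / 2 : R) <= 1 by apply/andP; split; lra.
have h4 : 0 <= (1 / 4 : R) <= 1 by apply/andP; split; lra.
(* The measure grows by at most 1 over a bias interval of length 1/4. *)
have IK : \sum_(j < n) Ex q n (pd j (ind R h)) <= 4.
  have := @Ex_ind_le1 R h (1 / 2) n h2.
  have : 0 <= Ex (1 / 4) n (ind R h) by apply: Ex_ge0 => // s _; exact: ind_ge0.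
  lra.
have I_ge0 j : 0 <= Ex q n (pd j (ind R h)).
  by apply: Ex_ge0 => // s _; rewrite -pd_sqr// sqr_ge0.
pose m := mkseq (fun j => M%:R^-1 ^+ 2 < Ex q n (pd j (ind R h))) n.
have mn : size m = n by rewrite size_mkseq.
have cm : (count id m <= core_size e)%N.
  have := le_trans (@count_mkseq_le n _ (M%:R^-1 ^+ 2) I_ge0 (sqr_ge0 _)) IK.
  rewrite [X in X * _]exprVn mulrC ler_pdivrMr ?exprn_gt0// => cm.
  by rewrite -(ler_nat R) /core_size natrM natrX.
have Ie j : (j < size m)%N -> ~~ nth false m j ->
    Ex q (size m) (pd j (ind R h)) <= M%:R^-1 ^+ 2.
  by rewrite mn => jn; rewrite nth_mkseq// -leNgt.
have Mi : 0 <= M%:R^-1 :> R by rewrite invr_ge0 ltW.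
have d0 : (0 < d)%N by rewrite muln_gt0.
have := @Ex_condVar_le R h h_up q m d M%:R^-1 4 q_itv d0 Mi _ Ie.
rewrite mn => /(_ IK).
have -> : 4 / d%:R + 4 ^+ d * M%:R^-1 * 4 = e%:R^-1 / 4 :> R.
  rewrite /M /noise_cst -/d /d !natrM natrX; field.
  by rewrite (gt_eqF eR) expf_neq0// pnatr_eq0.
have A_ge s : e%:R^-1 <= condE q m (ind R h) s.
  apply: le_trans (Ex_restr_le_condE q01 _ _ (@mono_ind R h h_up)).
  rewrite mn; apply: le_trans (unc m mn cm) _.
  apply: Ex_le_bias; first exact: upset_restr.
    by case/andP: q_itv => -> _; rewrite andbT; case/andP: h4.
  by case/andP: q01.
have A_le s : condE q m (ind R h) s <= 1 by apply: condE_le => // t; exact: ind_le1.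
have EA : Ex q n (condE q m (ind R h)) = Ex q n (ind R h) by rewrite -mn Ex_condE.
(* The conditional expectation A lies in [1/e, 1], so (1 - A) / e <= A - A^2 pointwise. The mean of
   A - A^2 is at most 1 / (4 e), hence that of A is at least 3/4. *)
have : 0 <= Ex q n (fun s =>
    (condE q m (ind R h) s - e%:R^-1) * (1 - condE q m (ind R h) s)).
  by apply: Ex_ge0 => // s _; rewrite mulr_ge0// subr_ge0.
under eq_Ex => s _.
  rewrite (_ : _ * _ = condE q m (ind R h) s - condE q m (ind R h) s ^+ 2
    - e%:R^-1 * (1 - condE q m (ind R h) s)); last by ring.
  over.
rewrite !ExB ExZ ExB Ex_cst EA => P1 P2.
have : e%:R^-1 * (1 - Ex q n (ind R h)) <= e%:R^-1 * (1 / 4).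
  by move: P1 P2; set a := Ex q n (ind R h); set b := Ex _ _ _; lra.
rewrite ler_pM2l ?invr_gt0// => P3.
have : Ex q n (ind R h) <= Ex (1 / 2) n (ind R h).
  apply: Ex_le_bias => //; last by lra.
  by case/andP: q_itv => _ ->; rewrite andbT; case/andP: q01.
lra.
Qed.

(** Complementation preserves the 1/2-biased measure, and [h] never holds at both [s] and its
    complement. *)
Lemma intersecting_half n h :
  (forall s, size s = n -> h s -> ~~ h (map negb s)) ->
  Ex (1 / 2 : R) n (ind R h) <= 1 / 2.
Proof.
move=> hI; have := Ex_half_negb n (ind R h) => hN.
suff : Ex (1 / 2 : R) n (ind R h) + Ex (1 / 2) n (fun s => ind R h (map negb s)) <= 1.
  by rewrite hN; lra.
rewrite -ExD -[leRHS](Ex_cst (1 / 2) n); apply: le_Ex.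
  by apply/andP; split; lra.
move=> s sn; rewrite /ind; have := hI s sn; case: (h s) => [/(_ isT)/negbTE ->|_].
  by rewrite addr0.
by rewrite add0r; case: (h _).
Qed.

End Uncapturable.

(** * From set families to up-sets of bit sequences *)

Section SetFamilies.
Variables (n : nat).
Implicit Types (F G : {set {set 'I_n}}) (A B J : {set 'I_n}) (s : seq bool).

Definition set_of s : {set 'I_n} := [set i : 'I_n | nth false s i].

Definition seq_of A : seq bool := [seq i \in A | i <- enum 'I_n].

Lemma size_seq_of A : size (seq_of A) = n.
Proof. by rewrite size_map size_enum_ord. Qed.

Lemma nth_seq_of A (i : 'I_n) : nth false (seq_of A) i = (i \in A).
Proof. by rewrite (nth_map i) ?size_enum_ord// nth_ord_enum. Qed.

Lemma seq_ofK : cancel seq_of set_of.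
Proof. by move=> A; apply/setP => i; rewrite inE nth_seq_of. Qed.

Lemma set_ofK s : size s = n -> seq_of (set_of s) = s.
Proof.
move=> sn; apply: (@eq_from_nth _ false); first by rewrite size_seq_of.
move=> i; rewrite size_seq_of => i_n.
by rewrite -[i]/(val (Ordinal i_n)) nth_seq_of inE.
Qed.

Lemma count_seq_of A : count id (seq_of A) = #|A|.
Proof.
by rewrite count_map cardE -size_filter enumT.
Qed.

Definition up F s := [exists B in F, B \subset set_of s].

Lemma upset_up F : upset (up F).
Proof.
move=> s t st /exists_inP[B BF /subsetP Bs]; apply/exists_inP; exists B => //.
by apply/subsetP => i /Bs; rewrite !inE; exact: st.
Qed.

Lemma up_intersecting F s : intersecting F -> size s = n -> up F s -> ~~ up F (map negb s).
Proof.
move=> FI sn /exists_inP[A AF /subsetP As]; apply/negP => /exists_inP[B BF /subsetP Bs].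
have /set0Pn[i] := FI _ _ AF BF; rewrite inE => /andP[/As iA /Bs].
by move: iA; rewrite !inE (nth_map false) ?sn// => ->.
Qed.

Lemma up_avoid F J s : size s = n ->
  up [set B in F | [disjoint B & J]] s ->
  up F (andS s (map negb (seq_of J))).
Proof.
move=> sn /exists_inP[B]; rewrite inE => /andP[BF BJ] /subsetP Bs.
apply/exists_inP; exists B => //; apply/subsetP => i iB.
rewrite inE nth_andS (nth_map false) ?size_seq_of// nth_seq_of.
by rewrite (disjointFr BJ iB) andbT; have := Bs i iB; rewrite inE.
Qed.

Lemma ExE (R : realFieldType) (q : R) f :
  Ex q n f = \sum_(A : {set 'I_n}) q ^+ #|A| * (1 - q) ^+ (n - #|A|) * f (seq_of A).
Proof.
transitivity (Ex q n (fun s => \sum_(A : {set 'I_n}) f (seq_of A) * (s == seq_of A)%:R)).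
  apply: eq_Ex => s sn; rewrite (bigD1 (set_of s))//= set_ofK// eqxx mulr1.
  rewrite big1 ?addr0// => A /eqP As; case: eqP => [sA|]; last by rewrite mulr0.
  by case: As; rewrite sA seq_ofK.
rewrite Ex_sum; apply: eq_bigr => A _.
by rewrite ExZ Ex_eq ?size_seq_of// count_seq_of mulrC.
Qed.

(** Complementation turns the supersets of [B] into the subsets of its complement. *)
Lemma card_supersets B (l : nat) : (l <= n)%N ->
  #|[set A : {set 'I_n} | (B \subset A) && (#|A| == l)]| = 'C(n - #|B|, n - l).
Proof.
move=> ln; have <- : #|~: B| = (n - #|B|)%N by have := cardsC B; rewrite card_ord; lia.
rewrite -(cards_draws (~: B)) -[RHS](card_preimset _ (@setC_inj 'I_n)).
apply: eq_card => A; rewrite !inE setCS; congr (_ && _).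
have := cardsC A; rewrite card_ord => An.
by apply/eqP/eqP; lia.
Qed.

Lemma sum_supersets (R : realFieldType) (g : nat -> R) B :
  \sum_(A : {set 'I_n} | B \subset A) g #|A| =
  \sum_(l < n.+1) g l *+ 'C(n - #|B|, n - l).
Proof.
have cn A : (#|A : {set 'I_n}| < n.+1)%N by rewrite ltnS -[leqRHS]card_ord max_card.
rewrite (partition_big (fun A => Ordinal (cn A)) predT)//=.
apply: eq_bigr => l _; have ln : (l <= n)%N by rewrite -ltnS ltn_ord.
rewrite -(card_supersets B ln) -[RHS]sumr_const.
rewrite big_mkcond [RHS]big_mkcond; apply: eq_bigr => A _; rewrite inE.
have -> : (Ordinal (cn A) == l) = (#|A| == l :> nat) by [].
by case: (_ \subset _); case: eqP => // ->.
Qed.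

(** Reverse Markov: the count is pointwise at most [k], plus [n] when it reaches [k]; take
    expectations. *)
Lemma tail_ge (R : realFieldType) (q : R) k : 0 <= q <= 1 -> (0 < n)%N ->
  q - k%:R / n%:R <= Ex q n (fun s => (k <= count id s)%:R).
Proof.
move=> q01 n0; have nR : 0 < n%:R :> R by rewrite ltr0n.
rewrite lerBlDr -(ler_pM2r nR) -Ex_count mulrDl divfK ?gt_eqF// mulrC -ExZ addrC.
rewrite -[X in _ <= X + _](Ex_cst q n) -ExD; apply: le_Ex => // s sn.
rewrite -natrM -natrD ler_nat; have := count_size id s; rewrite sn.
by case: leqP => /=; lia.
Qed.

(* Each set A is charged to the members of G below it, at most 'C(#|A|, k) many. *)
Lemma up_measure_ge (R : rcfType) (q : R) k G : 0 <= q <= 1 -> (0 < n)%N ->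
  uniform k G ->
  #|G|%:R * (q - k%:R / n%:R) <= 'C(n, k)%:R * Ex q n (ind R (up G)).
Proof.
move=> q01 n0 Gk; have /andP[q0 q1] := q01.
pose w l : R := q ^+ l * (1 - q) ^+ (n - l).
have w0 l : 0 <= w l by rewrite mulr_ge0 ?exprn_ge0// subr_ge0.
(* [g #|A|] is the share of each [k]-subset when the weight of [A] is split evenly; every [k]-set
   collects the same total [Z]. *)
pose g l := w l / 'C(l, k)%:R.
pose Z := \sum_(l < n.+1) g l *+ 'C(n - k, n - l).
have ZE B : #|B| = k -> \sum_(A : {set 'I_n} | B \subset A) g #|A| = Z.
  by move=> Bk; rewrite sum_supersets Bk.
have CZ : 'C(n, k)%:R * Z = Ex q n (fun s => (k <= count id s)%:R).
  have <- : #|[set B : {set 'I_n} | #|B| == k]| = 'C(n, k).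
    by rewrite card_draws card_ord.
  rewrite mulr_natl -sumr_const.
  under eq_bigr => B do rewrite inE => /eqP/ZE <-.
  rewrite (exchange_big_dep predT)//= ExE; apply: eq_bigr => A _.
  rewrite count_seq_of -/(w #|A|) sumr_const /g -[_ *+ _]mulr_natr -mulrA; congr (_ * _).
  have -> : #|[pred B in [set B : {set 'I_n} | #|B| == k] | B \subset A]| = 'C(#|A|, k).
    by rewrite -(cards_draws A k) cardsE; apply: eq_card => B; rewrite !inE andbC.
  case: leqP => kA; last by rewrite bin_small// mulr0.
  by rewrite mulVf// pnatr_eq0 -lt0n bin_gt0.
apply: (@le_trans _ _ (#|G|%:R * ('C(n, k)%:R * Z))).
  by rewrite ler_wpM2l// CZ tail_ge.
rewrite mulrCA ler_wpM2l// ExE mulr_natl -sumr_const.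
under eq_bigr => B BG do rewrite -(ZE B (Gk B BG)).
rewrite (exchange_big_dep predT)//=; apply: ler_sum => A _.
rewrite -/(w #|A|) sumr_const /g -[_ *+ _]mulr_natr -mulrA ler_wpM2l//.
set c := #|_|; rewrite /ind; case: (boolP (up G (seq_of A))) => [_|nup].
  have cA : (c <= 'C(#|A|, k))%N.
    rewrite -(cards_draws A k); apply: subset_leq_card; apply/subsetP => B.
    by rewrite !inE => /andP[/Gk -> ->]; rewrite eqxx.
  have [->|c0] := posnP c; first by rewrite mulr0.
  by rewrite mulrC ler_pdivrMr ?ltr0n ?(leq_trans c0)// mul1r ler_nat.
rewrite [c]eq_card0 ?mulr0// => B; rewrite !inE; apply/negbTE.
apply: contra nup => /andP[BG BA]; apply/exists_inP; exists B => //.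
by rewrite seq_ofK.
Qed.

End SetFamilies.

(** * Binomial estimates, use of regularity, and the final bound *)

(** The ratio of the binomials is the product of (n - j) / (k - j) over j < i, and each factor is at
    most r n / k because k <= r (k - j). *)
Lemma bin_ratio_le (n k r i : nat) : (i <= r <= k)%N -> (k <= n)%N ->
  ('C(n, k) * k ^ i <= (r * n) ^ i * 'C(n - i, k - i))%N.
Proof.
case/andP => ir rk kn; elim: i ir => [|i IH] ir; first by rewrite !expn0 !subn0 mulnC.
have -> : ('C(n, k) * k ^ i.+1 = 'C(n, k) * k ^ i * k)%N by rewrite expnSr mulnA.
apply: leq_trans (leq_mul (IH (ltnW ir)) (leqnn k)) _.
rewrite expnSr -!mulnA leq_mul2l; apply/orP; right.
have ki : (k <= r * (k - i))%N by nia.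
have step : ((k - i) * 'C(n - i, k - i) = (n - i) * 'C(n - i.+1, k - i.+1))%N.
  have -> : (k - i = (k - i.+1).+1)%N by lia.
  by rewrite -mul_bin_diag; congr (_ * 'C(_, _))%N; lia.
rewrite mulnC; apply: leq_trans (leq_mul ki (leqnn _)) _.
by rewrite -mulnA step leq_mul2l leq_mul2r leq_subr orbT orbT.
Qed.

(** The power comes from [bin_ratio_le] and n <= 8 k P; the 2 absorbs the loss in 1 / P - k / n >= 1
    / (2 P). *)
Definition size_cst (r : nat) := (2 * (8 * r) ^ r)%N.

(* The bias 4^-t is chosen comparable to k / n; passing from 4^-t to 1 / 4 then costs a
   t-th root, which turns a measure of order (k / n)^(r + 1) into a constant. *)
Lemma up_quarter_ge (R : rcfType) (n k r : nat) (G : {set {set 'I_n}}) :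
  (0 < r <= k)%N -> (8 * k <= n)%N -> uniform k G ->
  (size_cst r * 'C(n - r, k - r) <= #|G|)%N ->
  ((4 ^ r.+1)%N%:R)^-1 <= Ex (1 / 4 : R) n (ind R (up G)).
Proof.
case/andP => r0 rk nk Gk GK.
have k0 : (0 < k)%N by apply: leq_trans rk.
have n0 : (0 < n)%N by lia.
have x4 : (4 <= n %/ (2 * k))%N by rewrite leq_divRL ?muln_gt0//; lia.
(* [4 ^ t] is the largest power of 4 not above n / (2 k), so the bias 1 / P lies between 2 k / n and
   8 k / n. *)
set t := trunc_log 4 (n %/ (2 * k)).
have t0 : (0 < t)%N by rewrite /t trunc_log_gt0.
have /andP[tl tu] := trunc_log_bounds (isT : (1 < 4)%N) (leq_trans (isT : (0 < 4)%N) x4).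
rewrite -/t in tl tu; set P := (4 ^ t)%N in tl.
have P0 : (0 < P)%N by rewrite expn_gt0.
have Pl : (2 * k * P <= n)%N.
  by move: tl; rewrite leq_divRL ?muln_gt0// mulnC.
have Pu : (n <= 8 * k * P)%N.
  move: tu; rewrite ltn_divLR ?muln_gt0// expnS -/P => /ltnW.
  by have -> : (4 * P * (2 * k) = 8 * k * P)%N by lia.
have CG : (2 * 'C(n, k) <= P ^ r * #|G|)%N.
  have kr0 : (0 < k ^ r)%N by rewrite expn_gt0 k0.
  rewrite -(leq_pmul2r kr0) -mulnA.
  have B1 : ('C(n, k) * k ^ r <= (r * n) ^ r * 'C(n - r, k - r))%N.
    by apply: bin_ratio_le; [rewrite leqnn | lia].
  have B2 : ((r * n) ^ r <= (8 * r) ^ r * (P ^ r * k ^ r))%N.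
    by rewrite -!expnMn leq_exp2r//; nia.
  apply: leq_trans (leq_mul (leqnn 2) (leq_trans B1 (leq_mul B2 (leqnn _)))) _.
  have -> : (2 * ((8 * r) ^ r * (P ^ r * k ^ r) * 'C(n - r, k - r)) =
      P ^ r * k ^ r * (size_cst r * 'C(n - r, k - r)))%N by rewrite /size_cst; lia.
  by rewrite [leqRHS]mulnAC leq_mul2l GK orbT.
have h4 : 0 <= (1 / 4 : R) <= 1 by apply/andP; split; lra.
have PR : 0 < P%:R :> R by rewrite ltr0n.
have pE : (1 / 4 : R) ^+ t = P%:R^-1 by rewrite mul1r exprVn /P natrX.
have p01 : 0 <= (P%:R^-1 : R) <= 1 by rewrite invr_ge0 ler0n/= invf_le1// ler1n.
have nR : 0 < n%:R :> R by rewrite ltr0n.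
have kn : k%:R / n%:R <= P%:R^-1 / 2 :> R.
  rewrite ler_pdivrMr// mulrAC ler_pdivlMr// [leRHS]mulrC ler_pdivlMr//.
  by rewrite -!natrM ler_nat; lia.
have CR : 0 < 'C(n, k)%:R :> R by rewrite ltr0n bin_gt0; lia.
have main : (P%:R^-1 : R) ^+ r.+1 <= Ex P%:R^-1 n (ind R (up G)).
  rewrite -(ler_pM2l CR); apply: le_trans (up_measure_ge p01 n0 Gk).
  apply: (@le_trans _ _ (#|G|%:R * (P%:R^-1 / 2))); last by rewrite ler_wpM2l//; lra.
  rewrite exprS mulrCA -[leRHS]mulrCA ler_pM2l ?invr_gt0//.
  rewrite exprVn ler_pdivrMr ?exprn_gt0// mulrAC ler_pdivlMr// -natrX -!natrM ler_nat.
  by rewrite mulnC [leqRHS]mulnC.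
rewrite -pE -exprM in main.
have {main} := le_trans main (Ex_exp_le (@upset_up _ G) _ _ h4).
have E0 : 0 <= Ex (1 / 4 : R) n (ind R (up G)).
  by apply: Ex_ge0 => // s _; exact: ind_ge0.
have p4 : 0 <= (1 / 4 : R) ^+ r.+1 by apply: exprn_ge0; case/andP: h4.
(* Both sides are [t]-th powers of nonnegative numbers, and [t] is positive. *)
by rewrite mulnC exprM ler_pXn2r// mul1r exprVn natrX.
Qed.

(* By regularity the degree is k * #|F| / n, so few members meet a given small set. *)
Lemma regular_avoid_ge (n k : nat) (F : {set {set 'I_n}}) (J : {set 'I_n}) :
  (0 < n)%N -> uniform k F -> regular F ->
  (n * #|F| <= #|J| * k * #|F| + n * #|[set B in F | [disjoint B & J]]|)%N.
Proof.
move=> n0 Fk Freg.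
pose x0 : 'I_n := Ordinal n0; set d := degree F x0.
have dE x : (\sum_(B in F) (x \in B) = d)%N.
  rewrite /d (Freg x0 x) /degree -sum1_card big_mkcond [RHS]big_mkcond.
  by apply: eq_bigr => B _; rewrite inE; case: (B \in F); case: (x \in B).
have nd : (n * d = k * #|F|)%N.
  rewrite -[in LHS](card_ord n) -sum_nat_const.
  under eq_bigr => x _ do rewrite -(dE x).
  rewrite exchange_big /= mulnC -sum_nat_const; apply: eq_bigr => B /Fk <-.
  by rewrite -sum1_card [RHS]big_mkcond; apply: eq_bigr => x _; case: (x \in B).
(* A member either avoids [J] or is counted in the degree of some point of [J]. *)
have FD : (#|F| <= #|J| * d + #|[set B in F | [disjoint B & J]]|)%N.
  rewrite -sum_nat_const; under eq_bigr => x _ do rewrite -(dE x).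
  rewrite exchange_big /= -!sum1_card [X in (_ + X)%N]big_mkcond.
  rewrite [leqLHS]big_mkcond [X in (X + _)%N]big_mkcond -big_split /=.
  apply: leq_sum => B _; rewrite inE; case: (B \in F) => //=.
  case: (boolP [disjoint B & J]) => [_|]; first by rewrite addn1.
  rewrite disjoint_sym => /pred0Pn[x /andP[/= xJ xB]].
  by rewrite (bigD1 x)//= xB.
have := leq_mul (leqnn n) FD; rewrite mulnDr mulnCA nd.
by rewrite mulnA.
Qed.

Theorem theorem9 (R : realType) (r : nat) (hr : (0 < r)%N) :
  exists C : R, forall (n k : nat), (0 < n)%N -> (0 < k)%N ->
    C * k%:R < n%:R ->
    forall F : {set {set 'I_n}},
      uniform k F -> intersecting F -> regular F ->
      #|F|%:R <= C * (binz (n - r)%N (k%:Z - r%:Z))%:R.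
Proof.
pose e := (4 ^ r.+1)%N; pose sz := core_size e; pose K := size_cst r.
(* [2 * K] makes half of a too large [F] meet the bound of [up_quarter_ge], [2 * sz] lets half of
   [F] avoid the core, 8 gives 8 k <= n, and [r] settles the case k < r. *)
exists (2 * K + 2 * sz + 8 + r)%N%:R => n k n0 k0 + F Fk FI Freg.
rewrite -!natrM ltr_nat ler_nat => Ckn.
have [F_empty|[A AF]] := set_0Vmem F; first by rewrite F_empty cards0.
have F0 : (0 < #|F|)%N by apply/card_gt0P; exists A.
have [kr|rk] := ltnP k r.
  (* The binomial is 0 here, so a member [A] must be refuted: no member avoids [A], whence n <= k^2,
     against n > r k. *)
  have := regular_avoid_ge A n0 Fk Freg.
  have -> : [set B in F | [disjoint B & A]] = set0.
    apply/eqP; rewrite -subset0; apply/subsetP => B; rewrite inE => /andP[BF].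
    by rewrite -setI_eq0 (negbTE (FI B A BF AF)).
  rewrite (Fk A AF) cards0.
  rewrite muln0 addn0 leq_pmul2r// => nkk.
  by move: Ckn; rewrite ltnNge; case/negP; nia.
rewrite subzn//= leqNgt; apply/negP => Fbig.
have e0 : (0 < e)%N by rewrite expn_gt0.
have := @intersecting_half R n (up F) (fun s => @up_intersecting n F s FI).
rewrite leNgt => /negP; apply.
apply: (uncapturable_majority e0); first exact: upset_up.
move=> m mn cm; set J := set_of n m.
have mJ : m = seq_of J by rewrite set_ofK.
have cJ : (#|J| <= sz)%N by rewrite -count_seq_of -mJ.
set G := [set B in F | [disjoint B & J]].
have FG : (#|F| <= 2 * #|G|)%N.
  have := regular_avoid_ge J n0 Fk Freg; rewrite -/G => H.
  rewrite -(leq_pmul2l n0).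
  have : (2 * (#|J| * k * #|F|) <= n * #|F|)%N.
    by rewrite mulnA leq_mul2r; apply/orP; right; nia.
  lia.
have Gk : uniform k G by move=> B; rewrite inE => /andP[/Fk].
have h4 : 0 <= (1 / 4 : R) <= 1 by apply/andP; split; lra.
apply: (@le_trans _ _ (Ex (1 / 4) n (ind R (up G)))).
  apply: (up_quarter_ge R _ _ Gk); first by rewrite hr.
    by nia.
  rewrite -/K -(leq_pmul2l (isT : (0 < 2)%N)); apply: leq_trans FG.
  by apply: leq_trans (ltnW Fbig); rewrite mulnA leq_mul2r; apply/orP; right; lia.
apply: le_Ex => // s sn; rewrite /ind ler_nat mJ.
by case: (boolP (up G s)) => // /(up_avoid sn) ->.
Qed.
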